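(* As the integer $x\to\infty$, the averaged Chebyshev function $\widehat{\theta_{(2)}}(x)$ for prime doubles and the averaged prime-double counting function $\widehat{\pi_{(2)}}(x)$ satisfy $$\widehat{\theta_{(2)}}(x)\asymp \log(x)\,\widehat{\pi_{(2)}}(x),$$ that is, there are constants $0<c\le C$ and $x_0$ such that $c\log(x)\,\widehat{\pi_{(2)}}(x)\le\widehat{\theta_{(2)}}(x)\le C\log(x)\,\widehat{\pi_{(2)}}(x)$ for all integers $x\ge x_0$. Moreover, $$\lim_{x\to\infty}\frac{\widehat{\theta_{(2)}}(x)}{\log(x)}=\infty.$$
   Context: $\mu$ is the Möbius function, $\Lambda$ is the von Mangoldt function, and $\log$ is the natural logarithm. For a positive integer $i$ put $$\mu_{(2i)}(n)=\mu(n)\mu(n+2i),\qquad \lambda_{(2i)}(n)=\frac{\Lambda(n)\Lambda(n+2i)}{\log(n)\log(n+2i)}\quad(n\ge 2),$$ and for integers $x\ge2$ define $$\pi_{(2i)}(x)=\sum_{n=2}^{x}\mu_{(2i)}(n)\lambda_{(2i)}(n),\qquad \theta_{(2i)}(x)=\frac12\sum_{n=2}^{x}\mu_{(2i)}(n)\lambda_{(2i)}(n)\log\bigl(n(n+2i)\bigr).$$ For integers $x\ge 6$, $\widehat{\pi_{(2)}}(x)$ and $\widehat{\theta_{(2)}}(x)$ denote the arithmetic means of $\pi_{(2i)}(x)$ and $\theta_{(2i)}(x)$, respectively, over all integers $i$ with $4\le 2i\le x-2$. *)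

(* Defs.v *)
From HB Require Import structures.
From mathcomp Require Import all_boot all_order all_algebra.
From mathcomp Require Import classical_sets reals topology normedtype sequences.
From mathcomp Require Import exp.

Set Implicit Arguments.
Unset Strict Implicit.
Unset Printing Implicit Defensive.

Import Order.TTheory GRing.Theory Num.Theory.
Import numFieldNormedType.Exports.

Local Open Scope classical_set_scope.
Local Open Scope ring_scope.

(* [prime_decomp n] lists the pairs (p, k) of the factorisation of n as a
   product of powers p ^ k, k >= 1, of distinct primes; [prime_decomp 0] is
   empty, hence the guard. *)
Definition mobius (n : nat) : int :=
  if (0 < n)%N && all (fun pk => pk.2 == 1%N) (prime_decomp n)
  then (-1) ^+ size (prime_decomp n) else 0.

Definition mangoldt (R : realType) (n : nat) : R :=
  if prime_decomp n is [:: (p, _)] then ln p%:R else 0.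

Definition mobius2 (i n : nat) : int := mobius n * mobius (n + 2 * i).

Definition lambda2 (R : realType) (i n : nat) : R :=
  (mangoldt R n * mangoldt R (n + 2 * i)) / (ln n%:R * ln (n + 2 * i)%:R).

Definition pi2 (R : realType) (i x : nat) : R :=
  \sum_(2 <= n < x.+1) (mobius2 i n)%:~R * lambda2 R i n.

Definition theta2 (R : realType) (i x : nat) : R :=
  2^-1 * \sum_(2 <= n < x.+1)
    (mobius2 i n)%:~R * lambda2 R i n * ln (n * (n + 2 * i))%:R.

Definition shifts (x : nat) : {set 'I_x} :=
  [set i : 'I_x | (4 <= 2 * i <= x - 2)%N].

(* For x < 6 there is no shift and the mean is 0 / 0 = 0. *)
Definition shift_mean (R : realType) (f : nat -> nat -> R) (x : nat) : R :=
  (\sum_(i in shifts x) f i x) / #|shifts x|%:R.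

Definition pi2_hat (R : realType) (x : nat) : R := shift_mean (@pi2 R) x.

Definition theta2_hat (R : realType) (x : nat) : R := shift_mean (@theta2 R) x.

(* Main.v *)
Require Import Defs.
From HB Require Import structures.
From mathcomp Require Import all_boot all_order all_algebra.
From mathcomp Require Import classical_sets reals topology normedtype sequences.
From mathcomp Require Import exp.
From mathcomp Require Import zify ring lra.
Import Order.TTheory GRing.Theory Num.Theory.
Import numFieldNormedType.Exports.
Local Open Scope classical_set_scope.
Local Open Scope ring_scope.

(** For n >= 2 the product of the Moebius factor with the quotient of von
    Mangoldt functions and logarithms is the indicator of n and n + 2i being both
    prime: mu kills the proper prime powers on which Lambda lives, and the two
    signs -1 cancel ([mobius2_lambda2]).  Both means are therefore sums over the
    same finite set of prime pairs (n, n + 2i), with n <= x and 4 <= 2i <= x - 2,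
    divided by the same number of shifts: one counts the pairs ([pair_count]), the
    other weights each by half of log(n(n + 2i)) (half of [log_pair_sum]).

    The weights are at most (3/2) log x, which is the upper bound.  They are at
    least (1/4) log x unless n + 2i <= sqrt x, and at most x pairs are that small
    ([small_pairs_le]).  So the lower bound, and the divergence of the averaged
    theta over log x, both follow once the number of pairs is shown to exceed
    any multiple of x eventually ([pair_count_superlinear]); recall that there are at most x
    shifts.

    No information on individual gaps is needed for that: averaging over the
    shifts turns the problem into counting all pairs of odd primes p, q <= x with
    q >= p + 4, of which there are about pi(x)^2 / 2 ([sqr_odd_prime_pi_le]).
    Chebyshev's argument with the central binomial coefficient gives
    x <= 6 pi(x) log x ([chebyshev_lower]), and since log x <= 4 x^(1/4) this
    makes pi(x)^2 at least a constant times x^(3/2) ([sqr_prime_pi_lower]). *)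

(** * Chebyshev's lower bound for the number of primes *)

Definition prime_pi (x : nat) : nat := (\sum_(0 <= p < x.+1) prime p)%N.

(** In Legendre's formula the exponent of p in the central binomial coefficient
    is the sum over k of floor(2n / p^k) - 2 floor(n / p^k).  Each term is 0 or 1,
    and it vanishes as soon as p^k > 2n. *)
Lemma logn_central_bin p n : prime p ->
  (logn p 'C(2 * n, n) <= trunc_log p (2 * n))%N.
Proof.
move=> p_pr; have p_gt1 := prime_gt1 p_pr.
have binE : ('C(2 * n, n) * (n`! * n`!) = (2 * n)`!)%N.
  by have := @bin_fact (2 * n) n; rewrite mul2n -addnn addnK; apply; lia.
have bin_pos : (0 < 'C(2 * n, n))%N by rewrite bin_gt0; lia.
have := congr1 (logn p) binE.
rewrite !lognM ?muln_gt0 ?fact_gt0 // !logn_fact //.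
(* The sums for n! and (2n)! are put on the common range k <= 2n; the added
   terms vanish because p^k > n there. *)
set s1 := (\sum_(1 <= k < n.+1) _)%N; set s2 := (\sum_(1 <= k < _) _)%N.
move=> eqL.
suff : (s2 <= s1 + s1 + trunc_log p (2 * n))%N by lia.
have -> : s1 = (\sum_(1 <= k < (2 * n).+1) n %/ p ^ k)%N.
  rewrite (big_cat_nat (n := n.+1)) //=; last lia.
  rewrite [X in (_ + X)%N]big1_seq ?addn0 // => k /andP[_].
  rewrite mem_index_iota => /andP[ltnk _]; rewrite divn_small //.
  by apply: (ltn_trans (ltn_expl n p_gt1)); rewrite ltn_exp2l.
have trunc_le : (trunc_log p (2 * n) <= 2 * n)%N.
  have [->|n_gt0] := posnP n; first by rewrite trunc_log0.
  apply/ltnW/(leq_trans (ltn_expl _ p_gt1)).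
  by apply: trunc_logP; lia.
have -> : trunc_log p (2 * n)
    = (\sum_(1 <= k < (2 * n).+1) (k <= trunc_log p (2 * n)))%N.
  rewrite (big_cat_nat (n := (trunc_log p (2 * n)).+1)) //=.
  rewrite [X in (_ + X)%N]big1_seq ?addn0; last first.
    move=> k /andP[_]; rewrite mem_index_iota => /andP[ltk _].
    by rewrite leqNgt ltk.
  rewrite (eq_big_nat _ _ (F2 := fun=> 1%N)); last first.
    by move=> k /andP[_]; rewrite ltnS => ->.
  by rewrite sum_nat_const_nat; lia.
rewrite -!big_split /=; apply: leq_sum => k _.
have pk_gt0 : (0 < p ^ k)%N by rewrite expn_gt0; lia.
rewrite mul2n -addnn divnD // leq_add2l.
have [_|nle] := leqP k; first exact: leq_b1.
rewrite [nat_of_bool false]/= leqn0 eqb0 -ltnNge.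
have : (2 * n < p ^ k)%N.
  by apply: (leq_trans (trunc_log_ltn _ p_gt1)); rewrite leq_exp2l // mul2n -addnn.
have := leq_mod n (p ^ k); lia.
Qed.

Lemma exp2_le_central_bin n : (2 ^ n <= 'C(2 * n, n))%N.
Proof.
elim: n => [//|n IHn].
have -> : (2 * n.+1 = (2 * n).+2)%N by lia.
rewrite expnS binS.
have -> : 'C((2 * n).+1, n.+1) = 'C((2 * n).+1, n).
  by rewrite -bin_sub; [congr ('C(_, _)); lia | lia].
have : ('C(2 * n, n) <= 'C((2 * n).+1, n))%N by apply: leq_bin2l.
lia.
Qed.

(** Every prime divisor is at most 2n, and by [logn_central_bin] its full power is
    at most 2n as well, so the coefficient is a product of at most pi(2n) factors
    each at most 2n. *)
Lemma central_bin_le n : ('C(2 * n, n) <= (2 * n) ^ prime_pi (2 * n))%N.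
Proof.
have [->|n_gt0] := posnP n; first by rewrite bin0 /prime_pi big_nat1.
have bin_pos : (0 < 'C(2 * n, n))%N by rewrite bin_gt0; lia.
rewrite {1}(prod_prime_decomp bin_pos) prime_decompE big_map /=.
apply: (@leq_trans (\prod_(p <- primes 'C(2 * n, n)) (2 * n))).
  rewrite big_seq [leqRHS]big_seq; apply: leq_prod => p.
  rewrite mem_primes => /and3P[p_pr _ _].
  apply: (@leq_trans (p ^ trunc_log p (2 * n))); last first.
    by apply: trunc_logP; [exact: prime_gt1 | lia].
  by rewrite leq_exp2l ?prime_gt1 // logn_central_bin.
rewrite big_const_seq count_predT iter_muln_1 leq_exp2l; last lia.
rewrite /prime_pi -big_mkcond sum1_count -size_filter.
apply: uniq_leq_size; first exact: primes_uniq.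
move=> p p_in; rewrite mem_filter mem_index_iota /=.
move: p_in; rewrite mem_primes => /and3P[p_pr _ p_dv].
rewrite p_pr /= ltnS leqNgt; apply/negP => lt_p.
(* A prime p > 2n would divide (2n)!, against Legendre's formula. *)
have : (p %| (2 * n)`!)%N.
  by rewrite -(@bin_fact (2 * n) n) ?dvdn_mulr //; lia.
rewrite -[p]expn1 pfactor_dvdn ?fact_gt0 // logn_fact // big1_seq // => k /andP[_].
rewrite mem_index_iota => /andP[k_gt0 _]; rewrite divn_small // (leq_trans lt_p) //.
by rewrite -{1}[p]expn1 leq_exp2l ?prime_gt1.
Qed.

Lemma prime_pi_mono m n : (m <= n)%N -> (prime_pi m <= prime_pi n)%N.
Proof.
by move=> le; rewrite /prime_pi [leqRHS](big_cat_nat (n := m.+1)) ?leq_addr.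
Qed.

Lemma exp2_half_le x : (2 <= x)%N -> (2 ^ (x %/ 2) <= x ^ prime_pi x)%N.
Proof.
move=> x2; have le_x : (2 * (x %/ 2) <= x)%N by lia.
apply: (leq_trans (exp2_le_central_bin _)); apply: (leq_trans (central_bin_le _)).
apply: (@leq_trans (x ^ prime_pi (2 * (x %/ 2)))).
  have [->|?] := posnP (prime_pi (2 * (x %/ 2))); first by rewrite !expn0.
  by rewrite leq_exp2r.
by rewrite leq_exp2l // prime_pi_mono.
Qed.

(** * Pairs of primes *)

Definition pair_count (x : nat) : nat :=
  (\sum_(i in shifts x) \sum_(2 <= n < x.+1) (prime n && prime (n + 2 * i)))%N.

Lemma sum_pred1_le1 (m n c : nat) : (\sum_(m <= q < n) (q == c) <= 1)%N.
Proof.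
rewrite -big_mkcond sum1_count.
by rewrite (eq_count (a2 := pred1 c)) // count_uniq_mem ?iota_uniq ?leq_b1.
Qed.

Definition odd_prime (p : nat) : bool := prime p && odd p.

(** A larger odd prime q is reached from p by the admissible shift i = (q - p) / 2:
    2i <= x - 2 holds because p >= 2 and q <= x. *)
Lemma larger_odd_primes_le x p : (1 < p)%N ->
  (\sum_(0 <= q < x.+1) (odd_prime p && odd_prime q && (p + 4 <= q))
   <= \sum_(i in shifts x) (prime p && prime (p + 2 * i)))%N.
Proof.
move=> p_gt1.
apply: (@leq_trans (\sum_(0 <= q < x.+1) \sum_(i in shifts x)
   (q == p + 2 * i) * (prime p && prime (p + 2 * i)))).
  rewrite !big_nat; apply: leq_sum => q /andP[_ ltq].
  have [/andP[/andP[/andP[pp po] /andP[qp qo]] le]|//] := boolP (_ && _).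
  have lti : ((q - p) %/ 2 < x)%N by lia.
  have eqq : (p + 2 * ((q - p) %/ 2) = q)%N by lia.
  rewrite (bigD1 (Ordinal lti)) /=; last by rewrite inE /=; lia.
  by rewrite eqq eqxx pp qp.
rewrite exchange_big; apply: leq_sum => i _ /=.
rewrite -big_distrl /=.
by apply: (leq_trans (leq_mul (sum_pred1_le1 _ _ _) (leqnn _))); rewrite mul1n.
Qed.

Definition odd_prime_pi (x : nat) : nat := (\sum_(0 <= p < x.+1) odd_prime p)%N.

Lemma prime_pi_le_odd x : (prime_pi x <= odd_prime_pi x + 1)%N.
Proof.
apply: (@leq_trans (odd_prime_pi x + \sum_(0 <= p < x.+1) (p == 2))); last first.
  by rewrite leq_add2l sum_pred1_le1.
rewrite -big_split; apply: leq_sum => p _ /=; rewrite /odd_prime.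
have [p_pr|//] := boolP (prime p).
by have [->|->] := even_prime p_pr.
Qed.

Lemma odd_pairs_le x :
  (\sum_(0 <= p < x.+1) \sum_(0 <= q < x.+1)
      (odd_prime p && odd_prime q && (p + 4 <= q)) <= pair_count x)%N.
Proof.
rewrite /pair_count [leqRHS]exchange_big /=.
have [x_lt2|x_ge2] := ltnP x 2.
  rewrite !big_nat big1 // => p /andP[_ ltp]; rewrite big1 // => q _.
  by rewrite /odd_prime; case: p ltp => [|[|p]] //=; lia.
rewrite (big_cat_nat (n := 2)) //=; last lia.
rewrite [X in (X + _ <= _)%N]big_nat big1 ?add0n => [|p /andP[_ ltp]]; last first.
  by rewrite big1 // => q _; rewrite /odd_prime; case: p ltp => [|[|p]].
rewrite big_nat [leqRHS]big_nat; apply: leq_sum => p /andP[p_gt1 _].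
exact: larger_odd_primes_le.
Qed.

(** Two odd primes are equal, differ by exactly 2, or differ by at least 4.  The
    first two cases (equality, and the two orders of difference 2) account for at
    most pi(x) ordered pairs each, while each order of the last one is counted by
    [odd_pairs_le]. *)
Lemma sqr_odd_prime_pi_le x :
  (odd_prime_pi x ^ 2 <= 2 * pair_count x + 3 * odd_prime_pi x)%N.
Proof.
pose near (d p q : nat) : nat := (odd_prime p * (q == p + d))%N.
pose far (p q : nat) : nat := odd_prime p && odd_prime q && (p + 4 <= q)%N.
have near_sum d : (\sum_(0 <= p < x.+1) \sum_(0 <= q < x.+1) near d p q
    <= odd_prime_pi x)%N.
  apply: leq_sum => p _; rewrite -big_distrr /=.
  by apply: (leq_trans (leq_mul (leqnn _) (sum_pred1_le1 _ _ _))); rewrite muln1.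
have far_sum : (\sum_(0 <= p < x.+1) \sum_(0 <= q < x.+1) far p q
    <= pair_count x)%N by exact: odd_pairs_le.
apply: (@leq_trans (\sum_(0 <= p < x.+1) \sum_(0 <= q < x.+1)
   (near 0 p q + (near 2 p q + near 2 q p) + (far p q + far q p)))).
  rewrite -mulnn /odd_prime_pi big_distrlr /=.
  apply: leq_sum => p _; apply: leq_sum => q _.
  rewrite /near /far.
  case op: (odd_prime p) => //; case oq: (odd_prime q) => //=.
  move: op oq => /andP[_ op] /andP[_ oq]; lia.
under eq_bigr do rewrite !big_split /=.
rewrite !big_split /=.
rewrite [X in (_ + (_ + X) + _)%N]exchange_big /=.
rewrite [X in (_ + (_ + _) + (_ + X))%N]exchange_big /=.
have := near_sum 0%N; have := near_sum 2%N; lia.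
Qed.

(** With k odd primes, [sqr_odd_prime_pi_le] gives k^2 <= 4 pair_count once
    k >= 6, and pi(x) <= k + 1 <= 2k. *)
Lemma sqr_prime_pi_le x : (7 <= prime_pi x)%N ->
  (prime_pi x ^ 2 <= 16 * pair_count x)%N.
Proof.
move=> pi_ge; have := sqr_odd_prime_pi_le x; have := prime_pi_le_odd x; nia.
Qed.

(** * From the arithmetic weights to prime pairs *)

(** Lambda restricts n to prime powers and mu to squarefree numbers, leaving the
    primes, where mu is -1 and Lambda is log. *)
Lemma mobius_mangoldt (R : realType) n : (2 <= n)%N ->
  (mobius n)%:~R * (mangoldt R n / ln n%:R) = - (prime n)%:R :> R.
Proof.
move=> n_ge2; have ln_gt : 0 < ln n%:R :> R by rewrite ln_gt0 // ltr1n.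
have n_gt0 : (0 < n)%N by lia.
have [n_pr|n_npr] := boolP (prime n).
  have decomp : prime_decomp n = [:: (n, 1%N)].
    by rewrite prime_decompE primes_prime //= lognE n_pr n_gt0 dvdnn divnn n_gt0 logn1.
  by rewrite /mobius /mangoldt decomp n_gt0 /= expr1 divff ?gt_eqF // mulr1.
rewrite /mobius /mangoldt n_gt0 /= oppr0.
case decomp: (prime_decomp n) => [|[p e] [|]] //=; rewrite ?mul0r ?mulr0 //.
have [e1|] := eqVneq e 1%N; last by rewrite mul0r.
have p_pr : prime p.
  have [//] : [/\ prime p, (0 < e)%N & (p ^ e %| n)%N].
    by apply: mem_prime_decomp; rewrite decomp inE.
case/negP: n_npr; rewrite (prod_prime_decomp n_gt0) decomp big_seq1 /= e1.
by rewrite expn1.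
Qed.

Lemma mobius2_lambda2 (R : realType) i n : (2 <= n)%N ->
  (mobius2 i n)%:~R * lambda2 R i n = (prime n && prime (n + 2 * i))%:R :> R.
Proof.
move=> n_ge2; rewrite /mobius2 /lambda2 intrM.
transitivity (((mobius n)%:~R * (mangoldt R n / ln n%:R)) *
  ((mobius (n + 2 * i))%:~R * (mangoldt R (n + 2 * i) / ln (n + 2 * i)%:R)) : R).
  by rewrite invfM; ring.
rewrite !mobius_mangoldt //; last lia.
by rewrite mulrNN -natrM mulnb.
Qed.

Lemma pi2_hatE (R : realType) x :
  pi2_hat R x = (pair_count x)%:R / #|shifts x|%:R.
Proof.
rewrite /pi2_hat /shift_mean /pair_count natr_sum; congr (_ / _).
apply: eq_bigr => i _; rewrite natr_sum [RHS]big_nat /pi2 big_nat.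
by apply: eq_bigr => n /andP[n_ge2 _]; rewrite mobius2_lambda2.
Qed.

Definition log_pair_sum (R : realType) (x : nat) : R :=
  \sum_(i in shifts x) \sum_(2 <= n < x.+1)
    (prime n && prime (n + 2 * i))%:R * ln (n * (n + 2 * i))%:R.

Lemma theta2_hatE (R : realType) x :
  theta2_hat R x = 2^-1 * log_pair_sum R x / #|shifts x|%:R.
Proof.
rewrite /theta2_hat /shift_mean; congr (_ / _).
rewrite /log_pair_sum mulr_sumr; apply: eq_bigr => i _.
rewrite /theta2; congr (_ * _); rewrite big_nat [RHS]big_nat.
by apply: eq_bigr => n /andP[n_ge2 _]; rewrite mobius2_lambda2.
Qed.

(** * The number of primes exceeds a multiple of x^(3/4) *)

Lemma half_le_ln2 (R : realType) : 2^-1 <= ln 2 :> R.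
Proof.
have h : ln (1 + - 2^-1) <= - 2^-1 :> R by apply: le_ln1Dx; lra.
have e : 1 + - 2^-1 = 2^-1 :> R by field.
by move: h; rewrite e lnV ?posrE // lerN2.
Qed.

(** Taking logarithms in [exp2_half_le] gives floor(x / 2) log 2 <= pi(x) log x;
    the constant 6 comes from log 2 >= 1/2 and x <= 3 floor(x / 2). *)
Lemma chebyshev_lower (R : realType) x : (2 <= x)%N ->
  x%:R <= 6 * (prime_pi x)%:R * ln x%:R :> R.
Proof.
move=> x_ge2; have x_gt0 : 0 < x%:R :> R by rewrite ltr0n; lia.
have : ln (2 ^+ (x %/ 2)) <= ln (x%:R ^+ prime_pi x) :> R.
  by rewrite ler_ln ?posrE ?exprn_gt0 // -!natrX ler_nat exp2_half_le.
rewrite !lnXn // -!(mulr_natl (ln _)).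
have h : x%:R <= 3 * (x %/ 2)%:R :> R by rewrite -natrM ler_nat; lia.
have half : (x %/ 2)%:R * 2^-1 <= (x %/ 2)%:R * ln 2 :> R.
  by rewrite ler_wpM2l ?ler0n ?half_le_ln2.
lra.
Qed.

(** Put x = t^4 in Chebyshev's bound.  Since log x = 4 log t <= 4t, it becomes
    t^3 <= 24 pi(x), and the claim is the square of this. *)
Lemma sqr_prime_pi_lower (R : realType) x : (2 <= x)%N ->
  x%:R * Num.sqrt x%:R <= 576 * (prime_pi x)%:R ^+ 2 :> R.
Proof.
move=> x_ge2; have x_gt0 : 0 < x%:R :> R by rewrite ltr0n; lia.
set s := Num.sqrt x%:R; pose t := Num.sqrt s.
have s_gt0 : 0 < s by rewrite sqrtr_gt0.
have t_gt0 : 0 < t by rewrite sqrtr_gt0.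
have sE : s = t ^+ 2 by rewrite sqr_sqrtr // ltW.
have xE : x%:R = t ^+ 4 by rewrite (exprM t 2 2) -sE sqr_sqrtr // ltW.
have := chebyshev_lower R x x_ge2; rewrite xE lnXn // sE -mulr_natr.
set P := (prime_pi x)%:R => cheb.
have P_ge0 : 0 <= P by exact: ler0n.
have lnt := ln_sublinear t_gt0.
have cube : t ^+ 3 <= 24 * P.
  rewrite -(ler_pM2r t_gt0) -exprSr; apply: (le_trans cheb).
  have : P * ln t <= P * t by rewrite ler_wpM2l // ltW.
  lra.
have -> : t ^+ 4 * t ^+ 2 = (t ^+ 3) ^+ 2 by ring.
have -> : 576 * P ^+ 2 = (24 * P) ^+ 2 by ring.
by rewrite ler_sqr ?nnegrE ?mulr_ge0 ?exprn_ge0 // ltW.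
Qed.

(** For large x one has x sqrt x <= 576 pi(x)^2 <= 576 * 16 * pair_count x, and
    x sqrt x outgrows every linear function. *)
Lemma pair_count_superlinear (R : realType) (A : R) :
  \forall x \near \oo, A * x%:R <= (pair_count x)%:R.
Proof.
near=> x.
have x_ge2 : (2 <= x)%N by near: x; exact: nbhs_infty_ge.
have x_ge : 28 ^+ 2 <= x%:R :> R by near: x; exact: nbhs_infty_ger.
have x_geA : (16 * 576 * A) ^+ 2 <= x%:R by near: x; exact: nbhs_infty_ger.
have x_gt0 : 0 < x%:R :> R by rewrite ltr0n; lia.
have sqrt_ge c : c ^+ 2 <= x%:R -> c <= Num.sqrt x%:R :> R.
  by move=> ?; apply: (le_trans (ler_norm _)); rewrite -sqrtr_sqr ler_wsqrtr.
have s_geA := sqrt_ge _ x_geA; have s_ge := sqrt_ge _ x_ge.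
have low := sqr_prime_pi_lower R x x_ge2.
(* With x >= 28^2, at most six primes would give 28^3 <= 576 * 6^2, which is false. *)
have pi_ge7 : (7 <= prime_pi x)%N.
  rewrite leqNgt; apply/negP => pi_lt7.
  have pi_le : (prime_pi x)%:R <= 6 :> R by rewrite ler_nat.
  have pi_ge0 : 0 <= (prime_pi x)%:R :> R by exact: ler0n.
  have : (prime_pi x)%:R ^+ 2 <= 36 :> R by nra.
  nra.
have := sqr_prime_pi_le x pi_ge7; rewrite -(ler_nat R) natrX natrM => up.
have : x%:R * (16 * 576 * A) <= x%:R * Num.sqrt x%:R by rewrite ler_pM2l.
lra.
Unshelve. all: by end_near.
Qed.

(** * Bounds for the logarithmic weights *)

(** Here n(n + 2i) <= x (2x - 2) <= x^3. *)
Lemma log_pair_sum_upper (R : realType) x : (2 <= x)%N ->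
  log_pair_sum R x <= 3 * (ln x%:R * (pair_count x)%:R).
Proof.
move=> x_ge2; rewrite /log_pair_sum /pair_count mulrA natr_sum mulr_sumr.
apply: ler_sum => i; rewrite inE => /andP[_ i_le].
rewrite natr_sum mulr_sumr big_nat [leRHS]big_nat; apply: ler_sum => n /andP[n_ge2 n_le].
rewrite mulrC ler_wpM2r ?ler0n //.
rewrite mulr_natl -lnXn ?ltr0n; last lia.
rewrite -natrX ler_ln ?posrE ?ltr0n ?ler_nat; last 2 first.
- by rewrite muln_gt0; lia.
- by rewrite expn_gt0; lia.
apply: (@leq_trans (x * (x * x))); last by rewrite !expnS expn0 muln1.
by apply: leq_mul; [lia | nia].
Qed.

Lemma nat_sqrtP x : exists a, (a * a <= x < a.+1 * a.+1)%N.
Proof.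
elim: x => [|x [a /andP[a_le lt_a]]]; first by exists 0%N.
have [le|lt] := leqP (a.+1 * a.+1) x.+1; last by exists a; lia.
by exists a.+1; nia.
Qed.

(** If n + 2i <= a then both n and i lie between 1 and a. *)
Lemma small_pairs_le a x : (\sum_(i in shifts x) \sum_(2 <= n < x.+1)
    (n + 2 * i <= a) <= a * a)%N.
Proof.
apply: (@leq_trans (\sum_(i < x) \sum_(0 <= n < x.+1) (0 < i <= a) * (0 < n <= a))).
  rewrite big_mkcond /=; apply: leq_sum => i _; rewrite inE.
  case: ifP => // /andP[i_ge _].
  have [x_lt2|x_ge2] := ltnP x 2; first by rewrite big_geq.
  rewrite [leqRHS](big_cat_nat (n := 2)) //=; last lia.
  apply: leq_trans (leq_addl _ _).
  by rewrite big_nat [leqRHS]big_nat; apply: leq_sum => n; lia.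
under eq_bigr do rewrite -big_distrr /=.
rewrite -big_distrl /=.
have count b : (\sum_(0 <= n < b) (0 < n <= a) <= a)%N.
  apply: (@leq_trans (\sum_(1 <= n < a.+1) 1)); last by rewrite sum_nat_const_nat; lia.
  rewrite sum1_size -big_mkcond sum1_count -size_filter.
  apply: uniq_leq_size; first by rewrite filter_uniq ?iota_uniq.
  by move=> n; rewrite mem_filter !mem_index_iota; lia.
apply: leq_mul; rewrite ?count //.
by rewrite -(big_mkord xpredT (fun i => nat_of_bool (0 < i <= a)%N)).
Qed.

(** A pair with n + 2i > sqrt x satisfies (n(n + 2i))^2 >= x, so 2 log(n(n + 2i)) is
    at least log x; by [small_pairs_le] discarding the other pairs loses at most x. *)
Lemma log_pair_sum_lower (R : realType) x : (2 <= x)%N ->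
  ln x%:R * ((pair_count x)%:R - x%:R) <= 2 * log_pair_sum R x.
Proof.
move=> x_ge2; have [a /andP[a_le lt_a]] := nat_sqrtP x.
have lnx_ge0 : 0 <= ln x%:R :> R by rewrite ln_ge0 // ler1n; lia.
pose B := (\sum_(i in shifts x) \sum_(2 <= n < x.+1) (n + 2 * i <= a))%N.
have B_le : (B <= x)%N by apply: (leq_trans (small_pairs_le _ _)).
apply: (@le_trans _ _ (ln x%:R * ((pair_count x)%:R - B%:R))).
  by rewrite ler_wpM2l // lerB // ler_nat.
rewrite /pair_count /B /log_pair_sum !natr_sum -sumrB !mulr_sumr.
apply: ler_sum => i; rewrite inE => /andP[i_ge _].
rewrite !natr_sum -sumrB !mulr_sumr big_nat [leRHS]big_nat.
apply: ler_sum => n /andP[n_ge2 n_le].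
have ln_pos : 0 <= ln (n * (n + 2 * i))%:R :> R by rewrite ln_ge0 // ler1n; nia.
have [small|large] := leqP (n + 2 * i) a.
  apply: (@le_trans _ _ 0); last by rewrite !mulr_ge0 ?ler0n.
  by rewrite mulr_ge0_le0 // subr_le0 ler_nat leq_b1.
rewrite subr0; case: (_ && _); last by rewrite mulr0 mul0r mulr0.
rewrite mulr1 mul1r mulr_natl -lnXn ?ltr0n; last by nia.
rewrite -natrX ler_ln ?posrE ?ltr0n ?ler_nat ?expn_gt0; [|lia|nia].
have : (a.+1 * a.+1 <= n * (n + 2 * i) * (n * (n + 2 * i)))%N by apply: leq_mul; nia.
by rewrite -mulnn; lia.
Qed.

(** * The two means *)

(** Once there are at least 2x pairs, dropping x of them leaves at least half,
    which yields the constant 1/2 * 1/2 * 1/2. *)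
Lemma theta2_hat_lower (R : realType) :
  \forall x \near \oo, 8^-1 * (ln x%:R * pi2_hat R x) <= theta2_hat R x.
Proof.
near=> x.
have x_ge2 : (2 <= x)%N by near: x; exact: nbhs_infty_ge.
have large : 2 * x%:R <= (pair_count x)%:R :> R.
  by near: x; exact: pair_count_superlinear.
have lnx_ge0 : 0 <= ln x%:R :> R by rewrite ln_ge0 // ler1n; lia.
rewrite pi2_hatE theta2_hatE !mulrA ler_wpM2r ?invr_ge0 ?ler0n //.
have low := log_pair_sum_lower R x x_ge2.
nra.
Unshelve. all: by end_near.
Qed.

Lemma theta2_hat_upper (R : realType) x : (2 <= x)%N ->
  theta2_hat R x <= 3 / 2 * (ln x%:R * pi2_hat R x).
Proof.
move=> x_ge2; have up := log_pair_sum_upper R x x_ge2.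
rewrite pi2_hatE theta2_hatE !mulrA ler_wpM2r ?invr_ge0 ?ler0n //.
lra.
Qed.

Lemma pi2_hat_unbounded (R : realType) (A : R) :
  \forall x \near \oo, A <= pi2_hat R x.
Proof.
near=> x.
have x_ge6 : (6 <= x)%N by near: x; exact: nbhs_infty_ge.
have large : `|A| * x%:R <= (pair_count x)%:R :> R.
  by near: x; exact: pair_count_superlinear.
have card_gt0 : (0 < #|shifts x|)%N.
  have lt2x : (2 < x)%N by lia.
  by apply/card_gt0P; exists (Ordinal lt2x); rewrite inE /=; lia.
have card_le : (#|shifts x| <= x)%N by rewrite -[leqRHS]card_ord max_card.
rewrite pi2_hatE ler_pdivlMr ?ltr0n //; apply: le_trans large.
apply: (@le_trans _ _ (`|A| * #|shifts x|%:R)).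
  by rewrite ler_wpM2r ?ler0n ?ler_norm.
by rewrite ler_wpM2l ?ler_nat.
Unshelve. all: by end_near.
Qed.

Theorem mainTheorem3 (R : realType) :
  (exists (c C : R) (x0 : nat),
     [/\ 0 < c, c <= C &
       forall x : nat, (x0 <= x)%N ->
         c * (ln x%:R * pi2_hat R x) <= theta2_hat R x
         /\ theta2_hat R x <= C * (ln x%:R * pi2_hat R x)]) /\
  (theta2_hat R x / ln x%:R @[x --> \oo] --> +oo).
Proof.
split.
  have [x0 _ low] := theta2_hat_lower R.
  exists 8^-1, (3 / 2), (maxn 2 x0); split; [lra | lra |].
  move=> x; rewrite geq_max => /andP[x_ge2 x_ge]; split; first exact: low.
  exact: theta2_hat_upper.
apply/cvgryPge => A; near=> x.
have x_ge2 : (2 <= x)%N by near: x; exact: nbhs_infty_ge.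
have lnx_gt0 : 0 < ln x%:R :> R by rewrite ln_gt0 // ltr1n.
have low : 8^-1 * (ln x%:R * pi2_hat R x) <= theta2_hat R x.
  by near: x; exact: theta2_hat_lower.
have big : 8 * A <= pi2_hat R x by near: x; exact: pi2_hat_unbounded.
rewrite ler_pdivlMr //; apply: le_trans low.
nra.
Unshelve. all: by end_near.
Qed.
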